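(* Let $R$ be an associative unital $\mathbb K$-algebra, $V$ a right $R$-module and $\mathfrak g=\mathrm{End}_R(V)$ with the commutator bracket, viewed as a $\mathbb K$-Lie algebra. The $\mathrm{GL}_R(V)$-equivariant maps $\phi_{\mathcal P}:\mathcal P\to\mathcal G$, $p\mapsto\mathrm{ad}(p)$, and $\phi_{\mathcal C}:\mathcal C\to\mathcal F$, $E\mapsto\mathfrak f_E$, have the following properties: (1) For all $E\in\mathcal C$, $\phi_{\mathcal C}(E^\top)=\phi_{\mathcal C}(E)^\top$. (2) For all $p\in\mathcal P$, the restriction of $\phi_{\mathcal P}$ to the orbit $\mathrm{GL}_R(V).p$, $g.p\mapsto\mathrm{ad}(g.p)$, is injective. (3) For all $E\in\mathcal C$, the restriction of $\phi_{\mathcal C}$ to the orbit $\mathrm{GL}_R(V).E$, $g.E\mapsto\mathfrak f_{g.E}$, is injective. (4) Let $p\in\mathcal P$ with associated decomposition $V=E\oplus F=\mathrm{im}(p)\oplus\ker(p)$. The map $\phi_{\mathcal P}$ induces a bijection $$G(E,F)/H(E,F)\cong G(E,F).p\to G(\mathrm{ad}(p)).\mathrm{ad}(p)\cong G(\mathrm{ad}(p))/H(\mathrm{ad}(p)),$$ and the map $\phi_{\mathcal C}$ induces a bijection $$G(E,F)/P_F\cong G(E,F).F\to G(\mathrm{ad}(p)).\mathfrak f_F\cong G(\mathrm{ad}(p))/P^-.$$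
   Context: $\mathbb K$ is a commutative ring with unit in which $2,3$ are invertible. $\mathcal C$ is the set of $R$-submodules $E\subset V$ that admit a complementary $R$-submodule; $E^\top=\{F\in\mathcal C:V=E\oplus F\}$. $\mathcal P=\{p\in\mathrm{End}_R(V):p^2=p\}$, with $\mathrm{GL}_R(V)$ acting by $g.p=gpg^{-1}$. For the Lie algebra $\mathfrak g$: $\mathcal G=\{\mathrm{ad}(E_0):E_0\in\mathfrak g,\ \mathrm{ad}(E_0)^3=\mathrm{ad}(E_0)\}$; for $D\in\mathcal G$ with eigenspaces $\mathfrak g_i=\{X:DX=iX\}$ ($i=1,0,-1$), $\mathfrak f^+(D)=(\mathfrak g_1,\mathfrak g_0\oplus\mathfrak g_1)$, $\mathfrak f^-(D)=(\mathfrak g_{-1},\mathfrak g_0\oplus\mathfrak g_{-1})$ (flags of submodules of $\mathfrak g$), and $\mathcal F=\{\mathfrak f^+(D):D\in\mathcal G\}$. Flags $\mathfrak e=(\mathfrak e_1,\mathfrak e_0)$ and $\mathfrak f=(\mathfrak f_1,\mathfrak f_0)$ are transversal ($\mathfrak e\top\mathfrak f$) if $\mathfrak g=\mathfrak e_1\oplus\mathfrak f_0=\mathfrak f_1\oplus\mathfrak e_0$; for $\mathfrak f\in\mathcal F$, $\mathfrak f^\top=\{\mathfrak e\in\mathcal F:\mathfrak e\top\mathfrak f\}$. For $E\in\mathcal C$, $\mathfrak f_E=(\mathfrak f_1,\mathfrak f_0)$ with $\mathfrak f_1=\{X\in\mathfrak g:X(V)\subset E,\ X(E)=0\}$, $\mathfrak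 f_0=\{X\in\mathfrak g:X(E)\subset E\}$. If $p\in\mathcal P$ has $E=\mathrm{im}(p)$, $F=\ker(p)$, then $\mathrm{ad}(p)\in\mathcal G$, $\mathfrak f_E=\mathfrak f^+(\mathrm{ad}(p))$ and $\mathfrak f_F=\mathfrak f^-(\mathrm{ad}(p))$. $\mathrm{GL}_R(V)$ acts on $\mathfrak g$ by conjugation, hence on $\mathcal G$ and $\mathcal F$. For $E\in\mathcal C$: $U_E=\{1+X: X\in\mathfrak g, X(V)\subset E, X(E)=0\}\subset\mathrm{GL}_R(V)$. For $V=E\oplus F$, $G(E,F)\subset\mathrm{GL}_R(V)$ is the group generated by $U_E$ and $U_F$; it depends only on $E$ (resp. only on $F$). $P_F=\{g\in G(E,F):g(F)=F\}$, $H(E,F)=\{g\in G(E,F):g(E)=E,\ g(F)=F\}$. For $D\in\mathcal G$: $G(D)\subset\mathrm{Aut}(\mathfrak g)$ is generated by $e^{\mathrm{ad}\,x}=1+\mathrm{ad}\,x+\frac12(\mathrm{ad}\,x)^2$, $x\in\mathfrak g_1\cup\mathfrak g_{-1}$; it acts on $\mathcal G$ by conjugation and on $\mathcal F$ naturally. $H(D)=\{h\in G(D):hD=Dh\}$ and $P^-=P^-(D)=H(D)\,e^{\mathrm{ad}\,\mathfrak g_{-1}}$. *)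

(* Defs.v *)
From HB Require Import structures.
From mathcomp Require Import all_boot all_algebra.
From mathcomp Require Import boolp classical_sets functions.

Set Implicit Arguments.
Unset Strict Implicit.
Unset Printing Implicit Defensive.

Import GRing.Theory.

Local Open Scope classical_set_scope.
Local Open Scope ring_scope.

(* An associative unital K-algebra, given by its structure morphism K -> R with
   central image.  The library's [algType] would exclude the zero algebra. *)
Record pzAlgebra (K : comPzRingType) := PzAlgebra {
  alg_ring :> pzRingType;
  alg_map : {rmorphism K -> alg_ring};
  alg_central : forall (k : K) (r : alg_ring), alg_map k * r = r * alg_map k }.

#[key="L"]
HB.mixin Record Lmodule_isLieAlgebra (K : comPzRingType) L
    of GRing.Lmodule K L := {
  lie_bracket : L -> L -> L;
  lie_linear : forall y : L, linear (lie_bracket^~ y);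
  lie_alternating : forall x : L, lie_bracket x x = 0;
  lie_jacobi : forall x y z : L,
    lie_bracket x (lie_bracket y z) + lie_bracket y (lie_bracket z x)
      + lie_bracket z (lie_bracket x y) = 0
}.

#[short(type="lieAlgType")]
HB.structure Definition LieAlgebra (K : comPzRingType) :=
  {L of GRing.Lmodule K L & Lmodule_isLieAlgebra K L}.

Definition invertible (A : pzRingType) (a : A) : Prop :=
  exists b : A, a * b = 1 /\ b * a = 1.

(* The inverse of 2 when 2 is invertible (junk value 0 otherwise). *)
Definition inv_two (K : comPzRingType) : K := xget 0 [set k : K | k * 2%:R = 1].

(* A right R-module is a left module over the converse ring R^c. *)
Definition endR (K : comPzRingType) (R : pzAlgebra K) (V : lmodType R^c) :=
  {linear V -> V}.
Identity Coercion linear_of_endR : endR >-> GRing.Linear.type.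

Section EndAlgebra.
Variables (K : comPzRingType) (R : pzAlgebra K) (V : lmodType R^c).
Implicit Types (X Y Z : endR V) (k : K).

HB.instance Definition _ := gen_eqMixin (endR V).
HB.instance Definition _ := gen_choiceMixin (endR V).

Lemma endR_ext X Y : X =1 Y -> X = Y.
Proof.
case: X Y => [f [[a] [s]]] [g [[b] [t]]] /= /funext fg; subst g.
by rewrite (Prop_irrelevance a b) (Prop_irrelevance s t).
Qed.

Definition end_zero : endR V := \0 : {linear V -> V}.
Definition end_opp X : endR V := \- X : {linear V -> V}.
Definition end_add X Y : endR V := X \+ Y : {linear V -> V}.
Definition end_one : endR V := idfun : {linear V -> V}.
Definition end_mul X Y : endR V := X \o Y : {linear V -> V}.

Fact end_addA : associative end_add.
Proof. by move=> X Y Z; apply: endR_ext => v /=; rewrite addrA. Qed.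
Fact end_addC : commutative end_add.
Proof. by move=> X Y; apply: endR_ext => v /=; rewrite addrC. Qed.
Fact end_add0 : left_id end_zero end_add.
Proof. by move=> X; apply: endR_ext => v /=; rewrite add0r. Qed.
Fact end_addN : left_inverse end_zero end_opp end_add.
Proof. by move=> X; apply: endR_ext => v /=; rewrite addNr. Qed.

HB.instance Definition _ :=
  GRing.isZmodule.Build (endR V) end_addA end_addC end_add0 end_addN.

Fact end_mulA : associative end_mul.
Proof. by move=> X Y Z; apply: endR_ext. Qed.
Fact end_mul1l : left_id end_one end_mul.
Proof. by move=> X; apply: endR_ext. Qed.
Fact end_mul1r : right_id end_one end_mul.
Proof. by move=> X; apply: endR_ext. Qed.
Fact end_mulDl : left_distributive end_mul end_add.
Proof. by move=> X Y Z; apply: endR_ext. Qed.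
Fact end_mulDr : right_distributive end_mul end_add.
Proof. by move=> X Y Z; apply: endR_ext => v /=; rewrite linearD. Qed.

HB.instance Definition _ := GRing.Zmodule_isPzRing.Build (endR V)
  end_mulA end_mul1l end_mul1r end_mulDl end_mulDr.

(* k in K acts on V through its image in the centre of R. *)
Definition end_scale_fun k X : V -> V := fun v => (alg_map R k : R^c) *: X v.

Fact end_scale_linear k X : linear (end_scale_fun k X).
Proof.
move=> r u v; rewrite /end_scale_fun linearP scalerDr !scalerA.
by congr (_ *: _ + _); apply/esym/(alg_central (p := R) k r).
Qed.

HB.instance Definition _ k X :=
  GRing.isLinear.Build R^c V V *:%R (end_scale_fun k X) (end_scale_linear k X).

Definition end_scale k X : endR V := end_scale_fun k X : {linear V -> V}.

Fact end_scaleA k l X : end_scale k (end_scale l X) = end_scale (k * l) X.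
Proof.
apply: endR_ext => v; rewrite /= /end_scale_fun /= /end_scale_fun scalerA.
by rewrite mulrC rmorphM.
Qed.
Fact end_scale1 : left_id 1 end_scale.
Proof.
by move=> X; apply: endR_ext => v; rewrite /= /end_scale_fun rmorph1 scale1r.
Qed.
Fact end_scaleDr : right_distributive end_scale +%R.
Proof.
by move=> k X Y; apply: endR_ext => v; rewrite /= /end_scale_fun scalerDr.
Qed.
Fact end_scaleDl X : {morph end_scale^~ X : k l / k + l >-> k + l}.
Proof.
move=> k l; apply: endR_ext => v.
by rewrite /= /end_scale_fun rmorphD scalerDl.
Qed.

HB.instance Definition _ := GRing.Zmodule_isLmodule.Build K (endR V)
  end_scaleA end_scale1 end_scaleDr end_scaleDl.

Definition end_bracket X Y : endR V := X * Y - Y * X.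

Fact end_bracket_linear Y : linear (end_bracket^~ Y).
Proof.
move=> k X Z; rewrite /end_bracket mulrDl mulrDr opprD addrACA scalerBr.
congr (_ - _ + _); apply: endR_ext => v //.
by rewrite /= /end_scale_fun linearZ.
Qed.
Fact end_bracket_alt X : end_bracket X X = 0.
Proof. exact: subrr. Qed.
Fact end_bracket_jacobi X Y Z :
  end_bracket X (end_bracket Y Z) + end_bracket Y (end_bracket Z X)
    + end_bracket Z (end_bracket X Y) = 0.
Proof.
rewrite /end_bracket !mulrBr !mulrBl !mulrA !opprB !addrA.
rewrite [LHS](ACl ((1*12)*(7*2)*(3*10)*(5*4)*(11*6)*(9*8)))%AC /=.
by rewrite !subrr !addr0.
Qed.

HB.instance Definition _ := Lmodule_isLieAlgebra.Build K (endR V)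
  end_bracket_linear end_bracket_alt end_bracket_jacobi.

End EndAlgebra.

Section Units.
Variable A : pzRingType.

(* [unitRingType] is not used because it excludes the zero ring. *)
Record units := Units {
  uval : A;
  uinv : A;
  uvalK : uval * uinv = 1;
  uinvK : uinv * uval = 1 }.

Lemma units_ext (g h : units) : uval g = uval h -> g = h.
Proof.
case: g h => [a b ab ba] [a' b' ab' ba'] /= aa'; subst a'.
have bb' : b = b' by rewrite -[b]mulr1 -ab' mulrA ba mul1r.
by subst b'; rewrite (Prop_irrelevance ab ab') (Prop_irrelevance ba ba').
Qed.

HB.instance Definition _ := gen_eqMixin units.
HB.instance Definition _ := gen_choiceMixin units.

Definition units_one : units := Units (mulr1 1) (mulr1 1).
Definition units_inv (g : units) : units := Units (uinvK g) (uvalK g).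

Fact units_mul1 (g h : units) : (uval g * uval h) * (uinv h * uinv g) = 1.
Proof. by rewrite mulrA -[X in X * _]mulrA uvalK mulr1 uvalK. Qed.
Fact units_mul2 (g h : units) : (uinv h * uinv g) * (uval g * uval h) = 1.
Proof. by rewrite mulrA -[X in X * _]mulrA uinvK mulr1 uinvK. Qed.
Definition units_mul (g h : units) : units :=
  Units (units_mul1 g h) (units_mul2 g h).

Fact units_mulA : associative units_mul.
Proof. by move=> f g h; apply: units_ext; rewrite /= mulrA. Qed.
Fact units_mul1g : left_id units_one units_mul.
Proof. by move=> g; apply: units_ext; rewrite /= mul1r. Qed.
Fact units_mulg1 : right_id units_one units_mul.
Proof. by move=> g; apply: units_ext; rewrite /= mulr1. Qed.
Fact units_mulVg : left_inverse units_one units_inv units_mul.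
Proof. by move=> g; apply: units_ext; rewrite /= uinvK. Qed.
Fact units_mulgV : right_inverse units_one units_inv units_mul.
Proof. by move=> g; apply: units_ext; rewrite /= uvalK. Qed.

HB.instance Definition _ := isGroup.Build units
  units_mulA units_mul1g units_mulg1 units_mulVg units_mulgV.

End Units.

Section Groups.
Variable G : groupType.
Implicit Types (S H : set G).

Definition is_subgroup H : Prop :=
  H 1%g /\ (forall g h, H g -> H h -> H (g * h^-1)%g).

Definition generated S : set G := smallest is_subgroup S.

Definition left_coset H (g : G) : set G := [set (g * h)%g | h in H].

Definition left_cosets S H : set (set G) := [set left_coset H g | g in S].

Definition act_orbit (T : Type) (act : G -> T -> T) S (x : T) : set T :=
  [set act g x | g in S].

(* S/H -> S.x, gH |-> g.x is well defined and bijective. *)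
Definition act_orbit_iso (T : Type) (act : G -> T -> T) S H (x : T) : Prop :=
  exists f : set G -> T,
    (forall g, S g -> f (left_coset H g) = act g x) /\
    set_bij (left_cosets S H) (act_orbit act S x) f.

End Groups.

Section Submodules.
Variables (S : pzRingType) (M : lmodType S).
Implicit Types E F : set M.

Definition is_submodule E : Prop :=
  [/\ E 0, forall u v, E u -> E v -> E (u + v)
    & forall (a : S) u, E u -> E (a *: u)].

Definition set_add E F : set M := [set u + v | u in E & v in F].

Definition direct_sum E F : Prop :=
  set_add E F = [set: M] /\ E `&` F = [set 0].

(* The set C of submodules of M admitting a complementary submodule. *)
Definition compl_submodules : set (set M) :=
  [set E | is_submodule E /\ exists F, is_submodule F /\ direct_sum E F].

Definition complements E : set (set M) :=
  [set F | compl_submodules F /\ direct_sum E F].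

End Submodules.

Section LieAlgebra.
Variables (K : comPzRingType) (g : lieAlgType K).
Implicit Types (D : g -> g) (x y : g).

Definition ad x : g -> g := lie_bracket x.

Record lie_aut := LieAut {
  aut_fun :> g -> g;
  aut_inv : g -> g;
  aut_linear : linear aut_fun;
  aut_bracket : {morph aut_fun : x y / lie_bracket x y};
  aut_funK : cancel aut_fun aut_inv;
  aut_invK : cancel aut_inv aut_fun }.

Lemma lie_aut_ext (u v : lie_aut) : u =1 v -> u = v.
Proof.
case: u v => [a b al am ab ba] [a' b' al' am' ab' ba'] /= /funext aa'; subst a'.
have bb' : b = b' by apply/funext => x; rewrite -[in LHS](ba' x) ab.
by subst b'; congr LieAut; apply: Prop_irrelevance.
Qed.

HB.instance Definition _ := gen_eqMixin lie_aut.
HB.instance Definition _ := gen_choiceMixin lie_aut.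

Definition lie_aut_one : lie_aut.
Proof. by exists idfun idfun. Defined.

Definition lie_aut_inv (u : lie_aut) : lie_aut.
Proof.
exists (aut_inv u) (aut_fun u).
- by move=> k x y; apply: (can_inj (aut_funK u)); rewrite aut_linear !aut_invK.
- by move=> x y; apply: (can_inj (aut_funK u)); rewrite aut_bracket !aut_invK.
- exact: aut_invK.
- exact: aut_funK.
Defined.

Definition lie_aut_mul (u v : lie_aut) : lie_aut.
Proof.
exists (u \o v) (aut_inv v \o aut_inv u).
- by move=> k x y; rewrite /= !aut_linear.
- by move=> x y; rewrite /= !aut_bracket.
- by move=> x; rewrite /= !aut_funK.
- by move=> x; rewrite /= !aut_invK.
Defined.

Fact lie_aut_mulA : associative lie_aut_mul.
Proof. by move=> u v w; apply: lie_aut_ext. Qed.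
Fact lie_aut_mul1g : left_id lie_aut_one lie_aut_mul.
Proof. by move=> u; apply: lie_aut_ext. Qed.
Fact lie_aut_mulg1 : right_id lie_aut_one lie_aut_mul.
Proof. by move=> u; apply: lie_aut_ext. Qed.
Fact lie_aut_mulVg : left_inverse lie_aut_one lie_aut_inv lie_aut_mul.
Proof. by move=> u; apply: lie_aut_ext => x /=; rewrite aut_funK. Qed.
Fact lie_aut_mulgV : right_inverse lie_aut_one lie_aut_inv lie_aut_mul.
Proof. by move=> u; apply: lie_aut_ext => x /=; rewrite aut_invK. Qed.

HB.instance Definition _ := isGroup.Build lie_aut
  lie_aut_mulA lie_aut_mul1g lie_aut_mulg1 lie_aut_mulVg lie_aut_mulgV.

Definition gradings : set (g -> g) :=
  [set D | exists x, D = ad x /\ ad x \o ad x \o ad x = ad x].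

Definition eigenset D (i : int) : set g := [set x | D x = x *~ i].

(* A flag (f_1, f_0) of submodules f_1 <= f_0 is encoded as a pair. *)
Definition flag_plus D : set g * set g :=
  (eigenset D 1, set_add (eigenset D 0) (eigenset D 1)).

Definition flag_minus D : set g * set g :=
  (eigenset D (-1), set_add (eigenset D 0) (eigenset D (-1))).

Definition flags : set (set g * set g) := [set flag_plus D | D in gradings].

Definition transversal (e f : set g * set g) : Prop :=
  direct_sum e.1 f.2 /\ direct_sum f.1 e.2.

Definition flag_top (f : set g * set g) : set (set g * set g) :=
  [set e | flags e /\ transversal e f].

(* The automorphisms e^(ad x) = 1 + ad x + 1/2 (ad x)^2 with x in S. *)
Definition exp_ad (S : set g) : set lie_aut :=
  [set u | exists2 x, S x & forall y,
     u y = y + ad x y + inv_two K *: ad x (ad x y)].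

Definition elem_group D : set lie_aut :=
  generated (exp_ad (eigenset D 1 `|` eigenset D (-1))).

(* Natural actions of Aut(g) on gradings and flags. *)
Definition aut_grading (u : lie_aut) D : g -> g := u \o D \o aut_inv u.

Definition aut_flag (u : lie_aut) (f : set g * set g) : set g * set g :=
  (u @` f.1, u @` f.2).

Definition centr_group D : set lie_aut :=
  [set u | elem_group D u /\ u \o D = D \o u].

Definition parab_minus D : set lie_aut :=
  [set (h * e)%g | h in centr_group D & e in exp_ad (eigenset D (-1))].

End LieAlgebra.

Section Grassmannian.
Variables (K : comPzRingType) (R : pzAlgebra K) (V : lmodType R^c).
Notation GL := (units (endR V)).
Implicit Types (E F : set V) (g : GL) (X p : endR V).

Definition idempotents : set (endR V) := [set p | p * p = p].

Definition conj_end g X : endR V := uval g * X * uinv g.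

Definition conj_grading g (D : endR V -> endR V) : endR V -> endR V :=
  conj_end g \o D \o conj_end g^-1%g.

Definition conj_flag g (f : set (endR V) * set (endR V)) :=
  (conj_end g @` f.1, conj_end g @` f.2).

Definition act_set g E : set V := uval g @` E.

Definition flag_of E : set (endR V) * set (endR V) :=
  ([set X : endR V | (forall v, E (X v)) /\ (forall v, E v -> X v = 0)],
   [set X : endR V | forall v, E v -> E (X v)]).

Definition unip E : set GL :=
  [set g | exists2 X, (flag_of E).1 X & uval g = 1 + X].

Definition elem_GL E F : set GL := generated (unip E `|` unip F).

Definition stab_snd E F : set GL := [set g | elem_GL E F g /\ act_set g F = F].

Definition stab_both E F : set GL :=
  [set g | [/\ elem_GL E F g, act_set g E = E & act_set g F = F]].

Definition endo_im p : set V := range p.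

Definition endo_ker p : set V := [set v | p v = 0].

End Grassmannian.

Arguments idempotents {K R} V.
Arguments conj_end {K R V}.
Arguments conj_grading {K R V}.
Arguments conj_flag {K R V}.
Arguments act_set {K R V}.
Arguments flag_of {K R V}.
Arguments ad {K g}.
Arguments gradings {K} g.
Arguments flags {K} g.
Arguments aut_grading {K g}.
Arguments aut_flag {K g}.

(* Main.v *)
Require Import Defs.
From HB Require Import structures.
From mathcomp Require Import all_boot all_algebra.
From mathcomp Require Import boolp classical_sets functions.

Set Implicit Arguments.
Unset Strict Implicit.
Unset Printing Implicit Defensive.

Import GRing.Theory.

Local Open Scope classical_set_scope.
Local Open Scope ring_scope.

(** Everything rests on comparing gradings of g by their flags.  Let D = ad x
    with D^3 = D; as 2 is invertible, g is the sum of the eigenspaces of D for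
    1, 0, -1, and as 3 is invertible too, there is no room for the eigenvalue 2,
    so that the two steps of a flag are stable under the bracket in the way a
    parabolic subalgebra and its nilradical are.  If a flag e of this kind is
    transversal to the flag f^+(ad x) and moreover its big step contains x,
    then both steps of e are stable under ad x, hence graded, and
    transversality kills the components of the wrong degree: e = f^-(ad x)
    ([transversal_flag_minus]).

    For an idempotent p with image E and a flag e transversal to f_E, the
    containment can be forced.  Split p = a + q along the direct sum of f_1(E)
    and the big step of e.  Then pa = a and ap = 0 make q = p - a an idempotent
    with the same image E, and q lies in the big step of e, so e is the flag of
    ker q ([transversal_flag_of_im]).  This is (1).

    For (2), if ad (g p g^-1) = ad p then g p g^-1 = p + z with z central.
    Conjugating once more shows that p + 2z is idempotent too, and comparing
    the two equations of idempotency gives z = 0 ([ad_conj_inj_fix]).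

    For (3), if f_E = f_E' with E = im p and E' = im p', where p and p' are
    conjugate, then the flag of ker p' is transversal to f_E, so it is also
    the flag of ker q for some idempotent q with image E.  Now ad q and ad p'
    have the same two flags, hence are equal; q is conjugate to p by a
    unipotent element, so (2) gives q = p' and E = E' ([flag_of_act_inj]).

    For (4), conjugation by 1 + X with X^2 = 0 is exp (ad X), so G(ad p) is the
    image of G(E, F) in Aut(g) ([elem_group_ad]), which matches the orbits; the
    injectivity is (2) and (3).  The quotients are orbits modulo stabilisers
    ([act_orbit_iso_stabilizer]), and the one stabiliser that needs an argument
    is P^- ([parab_minus_stab]). *)

(** * Submodules and torsion *)

Lemma submoduleB (S : pzRingType) (M : lmodType S) (W : set M) u v :
  is_submodule W -> W u -> W v -> W (u - v).
Proof.
by case=> _ WD WZ Wu Wv; rewrite -scaleN1r; apply: WD => //; apply: WZ.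
Qed.

Section Torsion.
Variables (K : comPzRingType) (M : lmodType K).

Lemma invertible_mulrn_inj n (u : M) :
  invertible (n%:R : K) -> u *+ n = 0 -> u = 0.
Proof.
move=> [k [_ kn]] un; rewrite -[u]scale1r -kn -scalerA.
by rewrite scaler_nat un scaler0.
Qed.

Lemma inv_twoK (inv2 : invertible (2%:R : K)) (u : M) :
  inv_two K *: (u + u) = u.
Proof.
have [k [_ k2]] := inv2.
have h2 : inv_two K * 2%:R = 1.
  by apply: (@xgetPex _ 0 [set k : K | k * 2%:R = 1]); exists k.
by rewrite -mulr2n -scaler_nat scalerA h2 scale1r.
Qed.

Lemma eq_opp_0 (inv2 : invertible (2%:R : K)) (u : M) : u = - u -> u = 0.
Proof.
by move=> uN; apply: (invertible_mulrn_inj inv2); rewrite mulr2n {2}uN subrr.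
Qed.

End Torsion.

(** * Gradings of a Lie algebra and their flags *)

Section Gradings.
Variables (K : comPzRingType) (g : lieAlgType K).
Implicit Types x y z : g.

(** The structure of [g] provides linearity in the first argument only, and
    alternation yields antisymmetry only in presence of additivity in the
    second one. *)
Hypothesis ad_linear : forall x, linear (ad x).

Lemma adDr x y z : ad x (y + z) = ad x y + ad x z.
Proof. by have := ad_linear x 1 y z; rewrite !scale1r. Qed.

Lemma ad0r x : ad x 0 = 0.
Proof. by have := adDr x 0 0; rewrite addr0 -[LHS]addr0 => /addrI <-. Qed.

Lemma adZr k x y : ad x (k *: y) = k *: ad x y.
Proof. by have := ad_linear x k y 0; rewrite ad0r !addr0. Qed.

Lemma adNr x y : ad x (- y) = - ad x y.
Proof. by rewrite -scaleN1r adZr scaleN1r. Qed.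

Lemma adBr x y z : ad x (y - z) = ad x y - ad x z.
Proof. by rewrite adDr adNr. Qed.

Lemma ad_anti x y : ad x y = - ad y x.
Proof.
have adDl (u v w : g) : ad (u + v) w = ad u w + ad v w.
  by have := lie_linear w 1 u v; rewrite !scale1r.
have alt (u : g) : ad u u = 0 by apply: lie_alternating.
apply/eqP; rewrite -addr_eq0; apply/eqP.
by have := alt (x + y); rewrite adDl !adDr !alt addr0 add0r.
Qed.

Lemma adDl x y z : ad (x + y) z = ad x z + ad y z.
Proof. by rewrite ad_anti adDr opprD -!ad_anti. Qed.

Lemma adNl x y : ad (- x) y = - ad x y.
Proof. by rewrite ad_anti adNr opprK ad_anti. Qed.

Lemma ad_derivation x y z : ad x (ad y z) = ad (ad x y) z + ad y (ad x z).
Proof.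
have J : ad x (ad y z) + ad y (ad z x) + ad z (ad x y) = 0.
  exact: lie_jacobi.
apply/eqP; rewrite -subr_eq0 opprD -ad_anti -adNr -ad_anti addrA addrAC.
exact/eqP.
Qed.

Definition tripotent x := ad x \o ad x \o ad x = ad x.

Lemma tripotentE x y : tripotent x -> ad x (ad x (ad x y)) = ad x y.
Proof. by move=> /(congr1 (@^~ y)). Qed.

Lemma tripotentN x : tripotent x -> tripotent (- x).
Proof.
move=> tx; apply/funext => y /=.
by rewrite !adNl !adNr /= opprK tripotentE.
Qed.

Lemma eigenset1 x y : eigenset (ad x) 1 y = (ad x y = y).
Proof. by rewrite /eigenset /= mulr1z. Qed.

Lemma eigensetN1 x y : eigenset (ad x) (-1) y = (ad x y = - y).
Proof. by rewrite /eigenset /= mulrN1z. Qed.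

Lemma eigenset0 x y : eigenset (ad x) 0 y = (ad x y = 0).
Proof. by rewrite /eigenset /= mulr0z. Qed.

Lemma eigenset_submodule x i : is_submodule (eigenset (ad x) i).
Proof.
split; rewrite /eigenset /=; first by rewrite ad0r mul0rz.
- by move=> u v xu xv; rewrite adDr xu xv mulrzDl.
- by move=> k u xu; rewrite adZr /= xu scalerMzr.
Qed.

(** Replacing [x] by its opposite exchanges the two flags of the grading, so
    it is enough to study [flag_plus]. *)
Lemma flag_minus_opp x : flag_minus (ad x) = flag_plus (ad (- x)).
Proof.
suff eN i : eigenset (ad x) (- i) = eigenset (ad (- x)) i.
  by rewrite /flag_minus -{1}oppr0 !eN.
apply/funext => y; apply/propext; rewrite /eigenset /= adNl mulrNz.
by split=> [->|/eqP]; rewrite ?opprK // eqr_oppLR => /eqP.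
Qed.

(** An element [y] of the right-hand side splits as [y - ad x y] plus [ad x y],
    of degrees 0 and 1.  As an equation, the big step of a flag is visibly
    closed under the module operations. *)
Lemma flag_plus2E x :
  (flag_plus (ad x)).2 = [set y | ad x (ad x y) = ad x y].
Proof.
apply/seteqP; split=> [y [a a0 [b b1 <-]] | y /= xxy] /=.
  move: a0 b1; rewrite eigenset0 eigenset1 => a0 b1.
  by rewrite adDr a0 add0r !b1.
exists (y - ad x y); first by rewrite eigenset0 adBr /= xxy subrr.
by exists (ad x y); rewrite ?eigenset1 // subrK.
Qed.

Lemma flag_plus2_submodule x : is_submodule (flag_plus (ad x)).2.
Proof.
rewrite flag_plus2E; split=> /=; first by rewrite !ad0r.
- by move=> u v xu xv; rewrite !adDr xu xv.
- by move=> k u xu; rewrite !adZr /= xu.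
Qed.

Hypotheses (inv2 : invertible (2%:R : K)) (inv3 : invertible (3%:R : K)).

(** The projections onto the eigenspaces of an operator [D] with [D^3 = D] are
    the polynomials (D^2 + D)/2, 1 - D^2 and (D^2 - D)/2 in [D], so they
    preserve every [D]-stable submodule [W]. *)
Lemma grading_decomp x (W : set g) y : tripotent x -> is_submodule W ->
    (forall z, W z -> W (ad x z)) -> W y ->
  exists y1 y0 ym, [/\ y = y1 + y0 + ym,
    W y1 /\ ad x y1 = y1, W y0 /\ ad x y0 = 0 & W ym /\ ad x ym = - ym].
Proof.
move=> tx sW xW Wy; have [_ WD WZ] := sW.
exists (inv_two K *: (ad x (ad x y) + ad x y)), (y - ad x (ad x y)),
  (inv_two K *: (ad x (ad x y) - ad x y)).
split.
- rewrite addrAC -scalerDr addrACA subrr addr0 inv_twoK //.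
  by rewrite addrC subrK.
- split; first exact: (WZ _ _ (WD _ _ (xW _ (xW _ Wy)) (xW _ Wy))).
  by rewrite adZr adDr /= tripotentE // addrC.
- split; first exact: (submoduleB sW Wy (xW _ (xW _ Wy))).
  by rewrite adBr /= tripotentE // subrr.
- split; first exact: (WZ _ _ (submoduleB sW (xW _ (xW _ Wy)) (xW _ Wy))).
  by rewrite adZr adBr /= tripotentE // -scalerN opprB.
Qed.

Lemma grading_decompT x y : tripotent x ->
  exists y1 y0 ym, [/\ y = y1 + y0 + ym,
    ad x y1 = y1, ad x y0 = 0 & ad x ym = - ym].
Proof.
move=> tx.
have [|//||y1 [y0 [ym [? [_ ?] [_ ?] [_ ?]]]]] := @grading_decomp x setT y tx.
- by split.
- by [].
by exists y1, y0, ym.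
Qed.

Lemma flags_transversal x : tripotent x ->
  Defs.transversal (flag_plus (ad x)) (flag_minus (ad x)).
Proof.
suff ds z : tripotent z -> direct_sum (eigenset (ad z) 1) (flag_plus (ad (- z))).2.
  move=> tx; split; rewrite flag_minus_opp; first exact: ds.
  by rewrite -{2}(opprK x); apply/ds/tripotentN.
move=> tz; rewrite flag_plus2E; split.
  apply/seteqP; split=> // y _.
  have [y1 [y0 [ym [-> e1 e0 em]]]] := grading_decompT y tz.
  exists y1; rewrite ?eigenset1 //; exists (y0 + ym); rewrite ?addrA //=.
  by rewrite !adNl !adNr /= opprK !adDr /= e0 em ad0r adNr /= em !add0r opprK.
apply/seteqP; split=> [y [] | _ ->]; last first.
  by split; rewrite ?eigenset1 /= ?ad0r.
rewrite eigenset1 /= !adNl adNr opprK => e; rewrite !e.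
exact: eq_opp_0.
Qed.

Lemma plus1_bracket0 x y z : ad x y = y -> ad x z = 0 -> ad x (ad y z) = ad y z.
Proof. by move=> xy xz; rewrite ad_derivation xy xz ad0r addr0. Qed.

(** The bracket has degree 2, and [D^3 = D] on an eigenvector for 2 reads
    8 = 2 there: it is killed by 6. *)
Lemma plus1_bracket1 x y z : tripotent x ->
  ad x y = y -> ad x z = z -> ad y z = 0.
Proof.
move=> tx xy xz.
have x2 : ad x (ad y z) = ad y z *+ 2 by rewrite ad_derivation xy xz mulr2n.
have x6 : ad y z *+ 2 *+ 3 = 0.
  have := tripotentE (ad y z) tx; rewrite !(x2, mulr2n, adDr) => e.
  apply: (@addrI _ (ad y z + ad y z)); rewrite addr0 -[in RHS]e.
  by rewrite !mulrS mulr0n !addr0 !addrA.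
exact/(invertible_mulrn_inj inv2)/(invertible_mulrn_inj inv3).
Qed.

(** Degrees add up under the bracket, and [plus1_bracket1] leaves nothing in
    degree 2; so the big step of a flag is a subalgebra normalising the small
    one. *)
Lemma flag_plus1_stable X x y :
  tripotent X -> (flag_plus (ad X)).2 x -> ad X y = y -> ad X (ad x y) = ad x y.
Proof.
move=> tX [a + [b + <-]] Xy; rewrite eigenset0 eigenset1 => Xa Xb.
rewrite adDl (plus1_bracket1 tX Xb Xy) addr0.
by rewrite ad_derivation Xa Xy (ad_anti 0) ad0r oppr0 add0r.
Qed.

Lemma flag_plus2_stable X x y : tripotent X ->
  (flag_plus (ad X)).2 x -> (flag_plus (ad X)).2 y ->
  (flag_plus (ad X)).2 (ad x y).
Proof.
move=> tX Xx [c + [d + <-]]; rewrite eigenset0 eigenset1 => Xc Xd.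
rewrite adDr; have [_ WD _] := flag_plus2_submodule X.
apply: WD; last first.
  by rewrite flag_plus2E /=; rewrite !(flag_plus1_stable tX Xx Xd).
case: Xx => [a + [b + <-]]; rewrite eigenset0 eigenset1 => Xa Xb.
rewrite adDl flag_plus2E /=.
have -> : ad X (ad a c + ad b c) = ad b c.
  rewrite adDr (plus1_bracket0 Xb Xc) ad_derivation Xa Xc ad0r addr0.
  by rewrite (ad_anti 0) ad0r oppr0 add0r.
exact: plus1_bracket0.
Qed.

(** As [x] lies in the big step of the flag of [X], both steps of this flag are
    [ad x]-stable, hence are sums of eigenspace parts for [x].  Transversality
    makes the parts of degree 0 and 1 of the small step, and the part of degree 1
    of the big step, vanish; this gives one inclusion for each step, and the two
    direct sum decompositions force equality. *)
Lemma transversal_flag_minus x X : tripotent x -> tripotent X ->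
    Defs.transversal (flag_plus (ad X)) (flag_plus (ad x)) ->
    (flag_plus (ad X)).2 x ->
  flag_plus (ad X) = flag_minus (ad x).
Proof.
move=> tx tX [[sum1 cap1] [sum2 cap2]] Xx.
have sub1 y : ad X y = y -> ad x y = - y.
  move=> Xy.
  have [|||y1 [y0 [ym [ey [X1 x1] [X0 x0] [Xm xm]]]]] :=
    @grading_decomp x (flag_plus (ad X)).1 y tx.
  - exact: eigenset_submodule.
  - by move=> z; rewrite /= /eigenset /= !mulr1z; apply: flag_plus1_stable.
  - by rewrite /= eigenset1.
  have z1 : y1 = 0.
    suff : [set 0] y1 by [].
    by rewrite -cap1; split=> //; rewrite flag_plus2E /= !x1.
  have z0 : y0 = 0.
    suff : [set 0] y0 by [].
    by rewrite -cap1; split=> //; rewrite flag_plus2E /= !x0 ad0r.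
  by rewrite ey z1 z0 !add0r.
have sub2 y : (flag_plus (ad X)).2 y -> ad x (ad x y) = - ad x y.
  move=> Xy.
  have [||//|y1 [y0 [ym [ey [X1 x1] [X0 x0] [Xm xm]]]]] :=
    @grading_decomp x (flag_plus (ad X)).2 y tx.
  - exact: flag_plus2_submodule.
  - by move=> z; apply: flag_plus2_stable.
  have z1 : y1 = 0.
    suff : [set 0] y1 by [].
    by rewrite -cap2; split=> //; rewrite /= eigenset1.
  by rewrite ey z1 add0r !adDr x0 xm add0r ad0r add0r adNr xm.
rewrite [LHS]surjective_pairing [RHS]surjective_pairing.
congr pair; apply/seteqP.
  split=> y; rewrite /= eigenset1 eigensetN1; first exact: sub1.
  move=> xy; have : setT y by [].
  rewrite -sum1 flag_plus2E => -[u /= + [v xv uv]].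
  rewrite eigenset1 => Xu.
  have ev : v = y - u by rewrite -uv addrC addKr.
  have xv' : ad x v = - v by rewrite ev adBr xy (sub1 _ Xu) opprD.
  move: xv; rewrite !xv' adNr xv' opprK => /(eq_opp_0 inv2) v0.
  by rewrite -uv v0 addr0.
rewrite flag_minus_opp; split=> y.
  by move=> /sub2 xxy; rewrite flag_plus2E /= !adNl adNr xxy opprK.
rewrite [X in X y -> _]flag_plus2E /= !adNl adNr opprK => xxy.
have : setT y by [].
rewrite -sum2 => -[u /= + [v Xv uv]]; rewrite eigenset1 => xu.
have eu : u = y - v by rewrite -uv addrK.
have : ad x (ad x u) = - ad x u.
  by rewrite eu !adBr xxy (sub2 _ Xv) -opprD.
by rewrite !xu => /(eq_opp_0 inv2) u0; rewrite -uv u0 add0r.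
Qed.

(** The eigenspaces are recovered from the two flags: the small steps are those
    for 1 and -1, and the big steps meet in the one for 0. *)
Lemma flags_inj x x' : tripotent x -> tripotent x' ->
    flag_plus (ad x) = flag_plus (ad x') ->
    flag_minus (ad x) = flag_minus (ad x') ->
  ad x = ad x'.
Proof.
move=> tx tx' ep em; apply/funext => y.
have [y1 [y0 [ym [-> x1 x0 xm]]]] := grading_decompT y tx.
have x'1 : ad x' y1 = y1.
  by rewrite -eigenset1 -[eigenset _ _]/(flag_plus (ad x')).1 -ep /= eigenset1.
have x'm : ad x' ym = - ym.
  rewrite -eigensetN1 -[eigenset _ _]/(flag_minus (ad x')).1 -em.
  by rewrite /= eigensetN1.
have : (flag_plus (ad x')).2 y0 by rewrite -ep flag_plus2E /= !x0 ad0r.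
have : (flag_minus (ad x')).2 y0.
  by rewrite -em flag_minus_opp flag_plus2E /= !adNl x0 oppr0 ad0r oppr0.
rewrite flag_minus_opp !flag_plus2E /= !adNl adNr opprK => -> /esym.
move=> /(eq_opp_0 inv2) x'0.
by rewrite !adDr x1 x0 xm x'1 x'0 x'm.
Qed.

End Gradings.

(** * Generated subgroups and orbits *)

Section GroupActions.
Variable G : groupType.
Implicit Types S H : set G.

Lemma is_subgroupM H x y : is_subgroup H -> H x -> H y -> H (x * y)%g.
Proof.
case=> H1 HV Hx Hy; rewrite -[y]invgK; apply: (HV) => //.
by rewrite -[(y^-1)%g]mul1g; apply: HV.
Qed.

Lemma is_subgroupV H x : is_subgroup H -> H x -> H (x^-1)%g.
Proof. by case=> H1 HV Hx; rewrite -[(x^-1)%g]mul1g; apply: HV. Qed.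

Lemma generated_is_subgroup S : is_subgroup (generated S).
Proof.
split=> [H [[H1 _] _] // | x y Sx Sy H sH]; have [[_ HV] _] := sH.
by apply: HV; [apply: Sx | apply: Sy].
Qed.

Lemma sub_generated S : S `<=` generated S.
Proof. by move=> x Sx H [_]; apply. Qed.

Lemma generated_sub S H : is_subgroup H -> S `<=` H -> generated S `<=` H.
Proof. by move=> sH SH x; apply. Qed.

(** All four identifications of a quotient with an orbit are instances of this
    one, once the subgroup is recognised as a stabiliser. *)
Lemma act_orbit_iso_stabilizer (T : Type) (act : G -> T -> T) S (x : T) :
    is_subgroup S -> (forall y, act 1%g y = y) ->
    (forall a b y, act (a * b)%g y = act a (act b y)) ->
  act_orbit_iso act S [set a | S a /\ act a x = x] x.
Proof.
move=> sS act1 actM; set H := [set a | _].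
have actK a : cancel (act a) (act a^-1%g).
  by move=> y; rewrite -actM mulVg act1.
have H1 : H 1%g by split=> //; case: sS.
(* Any element of a coset may represent it; the default 1 is never used. *)
pose f C := act (xget 1%g C) x.
have fE a : f (left_coset H a) = act a x.
  have : left_coset H a (xget 1%g (left_coset H a)).
    by apply: (@xgetPex _ 1%g (left_coset H a)); exists a, 1%g; rewrite ?mulg1.
  by rewrite /f => -[h [_ hx] <-]; rewrite actM hx.
exists f; split=> [a _ // |]; split.
- by move=> _ [a Sa <-]; rewrite fE; exists a.
- have sub a b : S a -> S b -> act a x = act b x ->
      left_coset H a `<=` left_coset H b.
    move=> Sa Sb ab _ [h [Sh hx] <-]; exists (b^-1 * (a * h))%g.
      split; last by rewrite !actM hx ab actK.
      by do 2?[apply: is_subgroupM => //]; apply: is_subgroupV.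
    by rewrite mulgA mulgV mul1g.
  move=> _ _ /set_mem[a Sa <-] /set_mem[b Sb <-]; rewrite !fE => ab.
  by apply/seteqP; split; apply: sub.
- by move=> _ [a Sa <-]; exists (left_coset H a); rewrite ?fE //; exists a.
Qed.

End GroupActions.

Lemma image_generated (G G' : groupType) (f : G -> G') (S : set G) :
  {morph f : x y / (x * y)%g} -> f @` generated S = generated (f @` S).
Proof.
move=> fM.
have f1 : f 1%g = 1%g by apply: (mulgI (f 1%g)); rewrite -fM !mulg1.
have fV x : f (x^-1)%g = ((f x)^-1)%g.
  by apply: (mulgI (f x)); rewrite -fM !mulgV.
apply/seteqP; split.
  have [G1 GV] := generated_is_subgroup (f @` S).
  move=> _ [x Sx <-]; apply: (Sx (f @^-1` generated (f @` S))); split.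
    by split=> [|a b Sa Sb]; rewrite /preimage /= ?f1 // fM fV; apply: GV.
  by move=> y Sy; apply: sub_generated; exists y.
have [G1 GV] := generated_is_subgroup S.
apply: generated_sub; last first.
  by move=> _ [x Sx <-]; exists x => //; apply: sub_generated.
split; first by exists 1%g.
move=> _ _ [x Sx <-] [y Sy <-].
by exists (x * y^-1)%g; [apply: GV | rewrite fM fV].
Qed.

(** * Idempotents and their flags *)

Section Idempotents.
Variables (K : comPzRingType) (R : pzAlgebra K) (V : lmodType R^c).
Notation L := (endR V).
Notation GL := (units L).
Implicit Types (p q X Y : L) (E F : set V) (g h : GL).

Lemma end_adE X Y : ad X Y = X * Y - Y * X.
Proof. by []. Qed.

Lemma end_mulE X Y v : (X * Y) v = X (Y v).
Proof. by []. Qed.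

Fact end_ad_linear X : linear (@ad _ L X).
Proof.
move=> k Y Z.
have adN (u v : L) : ad u v = - ad v u by rewrite !end_adE opprB.
have -> : ad X (k *: Y + Z) = - (k *: ad Y X + ad Z X).
  by rewrite adN; congr (- _); apply: end_bracket_linear.
by rewrite opprD -scalerN -!adN.
Qed.

Lemma endo_imE p : idempotents V p -> endo_im p = [set v | p v = v].
Proof.
move=> pp; apply/seteqP; split=> [_ [v _ <-] | v pv] /=; last by exists v.
by rewrite -end_mulE pp.
Qed.

Lemma idempotentC p : idempotents V p -> idempotents V (1 - p).
Proof.
rewrite /idempotents /= => pp.
by rewrite mulrBl mul1r mulrBr mulr1 pp subrr subr0.
Qed.

Lemma endo_ker_im p : idempotents V p -> endo_ker p = endo_im (1 - p).
Proof.
move=> pp; rewrite (endo_imE (idempotentC pp)).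
apply/seteqP; split=> v; rewrite /endo_ker /=.
  by move=> ->; rewrite subr0.
by move/eqP; rewrite -subr_eq0 addrC addKr oppr_eq0 => /eqP.
Qed.

Lemma endo_im_eqP p q : idempotents V p -> idempotents V q ->
  endo_im p = endo_im q <-> p * q = q /\ q * p = p.
Proof.
move=> pp qq; split=> [e | [pq qp]].
  have im p' q' : idempotents V p' -> endo_im q' `<=` endo_im p' ->
      p' * q' = q'.
    move=> p'p' sub; apply: endR_ext => v; rewrite end_mulE.
    have : endo_im p' (q' v) by apply: sub; exists v.
    by rewrite endo_imE.
  by split; apply: im; rewrite // e.
rewrite !endo_imE //; apply/seteqP; split=> v /= <-.
  by rewrite -end_mulE qp.
by rewrite -end_mulE pq.
Qed.

Lemma ad_idempotent2 p X : idempotents V p ->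
  ad p (ad p X) = (p * X - p * X * p) - (p * X * p - X * p).
Proof.
rewrite /idempotents /= => pp.
by rewrite !end_adE mulrBr mulrBl !mulrA pp -[X * p * p]mulrA pp.
Qed.

Lemma ad_idempotent p : idempotents V p -> tripotent p.
Proof.
move=> pp; apply/funext => X /=; rewrite [X in X = _]ad_idempotent2 //.
move: pp; rewrite /idempotents /= => pp.
have ppr Y : Y * p * p = Y * p by rewrite -mulrA pp.
rewrite !end_adE !mulrBr !mulrBl !mulrA pp !ppr !subrr subr0 sub0r.
by rewrite opprK addrA subrK.
Qed.

Lemma flag_of_imE p : idempotents V p ->
  flag_of (endo_im p) =
    ([set X | p * X = X /\ X * p = 0], [set X | p * X * p = X * p]).
Proof.
move=> pp; rewrite endo_imE //; congr pair; apply/seteqP; split=> X /=.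
- move=> [pX X0]; split; apply: endR_ext => v; rewrite end_mulE ?pX //.
  by apply: X0; rewrite -end_mulE pp.
- move=> [pX X0]; split=> v; first by rewrite -end_mulE pX.
  by move=> <-; rewrite -end_mulE X0.
- move=> pX; apply: endR_ext => v; rewrite !end_mulE; apply: pX.
  by rewrite -end_mulE pp.
- by move=> pXp v pv; rewrite -[in RHS]pv -(end_mulE X) -pXp !end_mulE pv.
Qed.

Hypotheses (inv2 : invertible (2%:R : K)) (inv3 : invertible (3%:R : K)).

Lemma double_inj X Y : X + X = Y + Y -> X = Y.
Proof. by move=> e; rewrite -[X](inv_twoK inv2) e inv_twoK. Qed.

(** Written in blocks along the image and the kernel of [p], [ad p] multiplies
    the off-diagonal blocks by 1 and -1 and kills the diagonal ones. *)
Lemma flag_plus_ad p : idempotents V p ->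
  flag_plus (ad p) = flag_of (endo_im p).
Proof.
move=> pP; have pp := pP; rewrite /idempotents /= in pp.
have ppr (Y : L) : Y * p * p = Y * p by rewrite -mulrA pp.
rewrite flag_of_imE // [LHS]surjective_pairing; congr pair; last first.
  rewrite (flag_plus2E end_ad_linear); apply/seteqP; split=> X /=.
    rewrite ad_idempotent2 // end_adE => e; apply: double_inj.
    apply/eqP; rewrite -subr_eq0.
    have -> : p * X * p + p * X * p - (X * p + X * p) =
      p * X - X * p - (p * X - p * X * p - (p * X * p - X * p)).
      rewrite !opprB opprD !addrA.
      by rewrite [RHS](ACl ((1*6)*3*5*2*4))%AC /= subrr add0r.
    by rewrite e subrr.
  by move=> pXp; rewrite ad_idempotent2 // end_adE pXp subrr subr0.
apply/seteqP; split=> X; rewrite /= eigenset1 end_adE; last first.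
  by case=> -> ->; rewrite subr0.
move=> e.
have pXp : p * X * p = 0.
  have := congr1 (fun Y => p * Y) e; rewrite mulrBr !mulrA pp -[RHS]subr0.
  by move=> /addrI/oppr_inj.
have Xp : X * p = 0.
  have := congr1 (fun Y => Y * p) e; rewrite mulrBl ppr pXp sub0r.
  by move=> /esym/(eq_opp_0 inv2).
by move: e; rewrite Xp subr0.
Qed.

Lemma flag_minus_ad p : idempotents V p ->
  flag_minus (ad p) = flag_of (endo_ker p).
Proof.
move=> pp; rewrite (flag_minus_opp end_ad_linear) endo_ker_im //.
rewrite -flag_plus_ad; last exact: idempotentC.
congr (flag_plus _); apply/funext => X.
rewrite !end_adE mulrBl mulrBr mul1r mulr1 mulNr mulrN opprB opprK.
by rewrite [RHS]addrC addrA subrK addrC.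
Qed.

Lemma tripotent_gradings p : idempotents V p -> gradings L (ad p).
Proof. by move=> pp; exists p; split=> //; apply: ad_idempotent. Qed.

Lemma endo_im_submodule p : is_submodule (endo_im p).
Proof.
split; first by exists 0; rewrite ?linear0.
- by move=> _ _ [u _ <-] [v _ <-]; exists (u + v); rewrite ?linearD.
- by move=> a _ [u _ <-]; exists (a *: u); rewrite ?linearZ.
Qed.

Lemma endo_im_ker_sum p : idempotents V p -> direct_sum (endo_im p) (endo_ker p).
Proof.
move=> pp; rewrite endo_imE //; split.
  apply/seteqP; split=> // v _; exists (p v); first by rewrite /= -end_mulE pp.
  exists (v - p v); last by rewrite addrC subrK.
  by rewrite /endo_ker /= linearB /= -(end_mulE p p) pp subrr.
apply/seteqP; split=> [v [/= e pv] | _ ->]; first by rewrite -e; apply: pv.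
by split; rewrite /endo_ker /= linear0.
Qed.

Lemma projection_exists E F : is_submodule E -> is_submodule F ->
    direct_sum E F ->
  exists p, [/\ idempotents V p, endo_im p = E & endo_ker p = F].
Proof.
move=> sE sF [EF cap].
have /choice[f fP] v : exists u, E u /\ F (v - u).
  have : setT v by [].
  by rewrite -EF => -[u Eu [w Fw <-]]; exists u; rewrite addrC addKr.
have f_unique v u : E u -> F (v - u) -> f v = u.
  move=> Eu Fu; have [Ef Ff] := fP v; apply/eqP; rewrite -subr_eq0; apply/eqP.
  suff : [set 0] (f v - u) by [].
  rewrite -cap; split; first exact: (submoduleB sE).
  by have := submoduleB sF Fu Ff; rewrite opprB addrC addrA subrK.
have [E0 ED EZ] := sE; have [F0 FD FZ] := sF.
have f_linear : linear f.
  move=> a u v; have [Eu Fu] := fP u; have [Ev Fv] := fP v.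
  apply: f_unique; first by apply: ED => //; apply: EZ.
  by rewrite opprD addrACA -scalerBr; apply: FD => //; apply: FZ.
pose fL := GRing.isLinear.Build R^c V V *:%R f f_linear.
pose p : L := HB.pack_for {linear V -> V} f fL.
have fE u : E u -> f u = u by move=> Eu; apply: f_unique; rewrite ?subrr.
exists p; split.
- by apply: endR_ext => v; apply: fE; case: (fP v).
- apply/seteqP; split=> [_ [v _ <-] | v Ev]; first by case: (fP v).
  by exists v => //; apply: fE.
- apply/seteqP; split=> v; rewrite /endo_ker /=.
    by have [_ + fv] := fP v; rewrite [f v]fv subr0.
  by move=> Fv; apply: f_unique; rewrite ?subr0.
Qed.

Lemma compl_submodulesE E :
  compl_submodules E <-> exists p, idempotents V p /\ E = endo_im p.
Proof.
split=> [[sE [F [sF EF]]] | [p [pp ->]]].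
  by have [p [? <- _]] := projection_exists sE sF EF; exists p.
split; first exact: endo_im_submodule.
exists (endo_ker p); split; last exact: endo_im_ker_sum.
by rewrite endo_ker_im //; apply: endo_im_submodule.
Qed.

(** Subtracting from [p] its component in the small step of [flag_of (endo_im p)]
    changes the kernel but not the image, and moves [p] into the big step of [e],
    where [transversal_flag_minus] applies. *)
Lemma transversal_flag_of_im p e : idempotents V p -> flags L e ->
    Defs.transversal e (flag_of (endo_im p)) ->
  exists q,
    [/\ idempotents V q, endo_im q = endo_im p & e = flag_of (endo_ker q)].
Proof.
move=> pp [_ [X [-> tX] <-]] tr.
have [_ [sum _]] := tr; have : setT p by [].
rewrite -sum flag_of_imE // => -[a [pa ap] [q Xq]] /esym pE.
have qE : q = p - a by rewrite pE addrC addKr.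
have aa : a * a = 0 by rewrite -[X in _ * X]pa mulrA ap mul0r.
have pq : p * q = q by rewrite qE mulrBr pp pa.
have qp : q * p = p by rewrite qE mulrBl pp ap subr0.
have qq : idempotents V q.
  by rewrite /idempotents /= {1}qE mulrBl pq [X in a * X]qE mulrBr ap aa !subr0.
have im : endo_im q = endo_im p by apply/endo_im_eqP.
exists q; split=> //; rewrite -flag_minus_ad //.
apply: (transversal_flag_minus end_ad_linear inv2 inv3) => //.
  exact: ad_idempotent.
by rewrite (flag_plus_ad qq) im.
Qed.

(** * Conjugation *)

Lemma unitKv g v : uinv g (uval g v) = v.
Proof. by rewrite -end_mulE uinvK. Qed.

Lemma unitVKv g v : uval g (uinv g v) = v.
Proof. by rewrite -end_mulE uvalK. Qed.

Lemma conj_end1 X : conj_end 1%g X = X.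
Proof. by rewrite /conj_end /= mul1r mulr1. Qed.

Lemma conj_endM g h X : conj_end (g * h)%g X = conj_end g (conj_end h X).
Proof. by rewrite /conj_end /= !mulrA. Qed.

Lemma conj_endK g : cancel (conj_end g) (conj_end g^-1%g).
Proof. by move=> X; rewrite -conj_endM mulVg conj_end1. Qed.

Lemma conj_endKV g : cancel (conj_end g^-1%g) (conj_end g).
Proof. by move=> X; rewrite -conj_endM mulgV conj_end1. Qed.

Lemma conj_end_mul g X Y : conj_end g (X * Y) = conj_end g X * conj_end g Y.
Proof. by rewrite /conj_end !mulrA -[_ * uinv g * uval g]mulrA uinvK mulr1. Qed.

Lemma conj_end_linear g : linear (conj_end g).
Proof.
move=> k X Y; rewrite /conj_end mulrDr mulrDl; congr (_ + _).
by apply: endR_ext => v; rewrite /= /end_scale_fun linearZ.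
Qed.

Lemma conj_endD g X Y : conj_end g (X + Y) = conj_end g X + conj_end g Y.
Proof. by rewrite /conj_end mulrDr mulrDl. Qed.

Lemma conj_endB g X Y : conj_end g (X - Y) = conj_end g X - conj_end g Y.
Proof. by rewrite /conj_end mulrBr mulrBl. Qed.

Lemma conj_idempotent g p : idempotents V p -> idempotents V (conj_end g p).
Proof. by rewrite /idempotents /= -conj_end_mul => ->. Qed.

Lemma act_setE g E : act_set g E = [set v | E (uinv g v)].
Proof.
apply/seteqP; split=> [_ [u Eu <-] | v Ev] /=.
  by rewrite -end_mulE uinvK.
by exists (uinv g v); rewrite // -end_mulE uvalK.
Qed.

Lemma act_set1 E : act_set 1%g E = E.
Proof. by rewrite act_setE. Qed.

Lemma act_setM g h E : act_set (g * h)%g E = act_set g (act_set h E).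
Proof. by rewrite !act_setE. Qed.

Lemma endo_im_conj g p : endo_im (conj_end g p) = act_set g (endo_im p).
Proof.
rewrite act_setE; apply/seteqP; split=> [_ [v _ <-] | v [u _ pu]] /=.
  by exists (uinv g v); rewrite //= unitKv.
by exists (uval g u); rewrite //= unitKv pu unitVKv.
Qed.

Lemma endo_ker_conj g p : endo_ker (conj_end g p) = act_set g (endo_ker p).
Proof.
rewrite act_setE; apply/seteqP; split=> v pv; rewrite /endo_ker /=; last first.
  by rewrite pv linear0.
by rewrite -[LHS](unitKv g) [X in uinv g X]pv linear0.
Qed.

Lemma ad_conj_end g X : ad (conj_end g X) = conj_grading g (ad X).
Proof.
apply/funext => Y.
rewrite -[RHS]/(conj_end g (ad X (conj_end g^-1%g Y))) !end_adE.
by rewrite conj_endB (conj_end_mul g X) (conj_end_mul g _ X) conj_endKV.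
Qed.

Lemma image_conj_end g (A : set L) :
  conj_end g @` A = [set X | A (conj_end g^-1%g X)].
Proof.
apply/seteqP; split=> [_ [X AX <-] | X AX] /=; first by rewrite conj_endK.
by exists (conj_end g^-1%g X); rewrite ?conj_endKV.
Qed.

Lemma flag_of_act_set g E : flag_of (act_set g E) = conj_flag g (flag_of E).
Proof.
rewrite /conj_flag !image_conj_end act_setE.
congr pair; apply/seteqP; split=> X /=.
- move=> [XE X0]; split=> v; rewrite /=; first exact: XE.
  by move=> Ev; rewrite X0 ?linear0 //= unitKv.
- move=> [XE X0]; split=> v.
    by have := XE (uinv g v); rewrite /= unitVKv.
  by move=> /X0 /(congr1 (uval g)); rewrite /= !unitVKv linear0.
- by move=> XE v Ev; rewrite /=; apply: XE; rewrite /= unitKv.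
- by move=> XE v /XE; rewrite /= unitVKv.
Qed.

(** The conjugate is [p + z] with [z] central, and a second conjugation by [g]
    gives the idempotent [p + z + z].  Idempotency of both reads 2pz + z^2 = z
    and 4pz + 4z^2 = 2z; hence 2z^2 = 0, so z^2 = 0 and 2pz = z, and multiplying
    by [p] yields pz = 0. *)
Lemma ad_conj_inj_fix p g : idempotents V p ->
  ad (conj_end g p) = ad p -> conj_end g p = p.
Proof.
move=> pP adE; have pp := pP; rewrite /idempotents /= in pp.
pose z := conj_end g p - p.
have gp : conj_end g p = p + z by rewrite addrC subrK.
have zC X : z * X = X * z.
  have : ad z X = 0.
    by rewrite (adDl end_ad_linear) (adNl end_ad_linear) adE subrr.
  by rewrite end_adE => /subr0_eq.
have shift w : (forall X, w * X = X * w) -> idempotents V (p + w) ->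
    p * w + p * w + w * w = w.
  move=> wC; rewrite /idempotents /= mulrDl !mulrDr wC pp -addrA => /addrI.
  by rewrite addrA.
have gz : conj_end g z = z by rewrite /conj_end -zC -mulrA uvalK mulr1.
have e1 : p * z + p * z + z * z = z.
  by apply: shift; rewrite // -gp; apply: conj_idempotent.
have e2 : p * (z + z) + p * (z + z) + (z + z) * (z + z) = z + z.
  apply: shift; first by move=> X; rewrite mulrDl mulrDr zC.
  rewrite addrA -gp -{1}gz -conj_endD -gp.
  by do 2!apply: conj_idempotent.
clearbody z; have zz : z * z = 0.
  apply: (invertible_mulrn_inj inv2); rewrite mulr2n.
  apply: (@addrI _ (z + z)); rewrite addr0 -[in RHS]e2 -{1 2}e1.
  rewrite !(mulrDl, mulrDr) !addrA.
  by rewrite [LHS](ACl (1*2*4*5*3*6*7*8))%AC.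
have pz2 : p * z + p * z = z by move: e1; rewrite zz addr0.
have pz : p * z = 0.
  have := congr1 (fun X => p * X) pz2; rewrite mulrDr mulrA pp.
  by rewrite -[RHS]addr0 => /addrI.
by rewrite gp -pz2 pz !addr0.
Qed.

Lemma ad_conj_inj p g h : idempotents V p ->
  ad (conj_end g p) = ad (conj_end h p) -> conj_end g p = conj_end h p.
Proof.
move=> pp e; apply: (can_inj (conj_endKV h)); rewrite conj_endK -conj_endM.
apply: ad_conj_inj_fix => //.
rewrite conj_endM ad_conj_end e -ad_conj_end; congr ad; exact: conj_endK.
Qed.

(** * Unipotent elements *)

Lemma flag_of1_square0 E X : (flag_of E).1 X -> X * X = 0.
Proof. by case=> XE X0; apply: endR_ext => v; rewrite end_mulE X0. Qed.

Lemma square0_mul1D X : X * X = 0 -> (1 + X) * (1 - X) = 1.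
Proof. by move=> XX; rewrite mulrDl mul1r mulrBr mulr1 XX subr0 subrK. Qed.

Lemma square0_mul1B X : X * X = 0 -> (1 - X) * (1 + X) = 1.
Proof. by move=> XX; rewrite -{2}[X]opprK square0_mul1D // mulrNN. Qed.

Definition unip_unit X (XX : X * X = 0) : GL :=
  Units (square0_mul1D XX) (square0_mul1B XX).

Lemma unip_uinv X g : X * X = 0 -> uval g = 1 + X -> uinv g = 1 - X.
Proof.
by move=> XX gX; rewrite (units_ext (gX : uval g = uval (unip_unit XX))).
Qed.

(** As [p - q] maps into the common image and vanishes on it, [1 + (p - q)] is
    unipotent. *)
Lemma unip_conj_same_im p q : idempotents V p -> idempotents V q ->
  endo_im p = endo_im q -> exists2 h, unip (endo_im p) h & q = conj_end h p.
Proof.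
move=> pp qq im; have [pq qp] := (endo_im_eqP pp qq).1 im.
have pE : p * p = p by [].
have Xf : (flag_of (endo_im p)).1 (p - q).
  by rewrite flag_of_imE //=; rewrite mulrBr mulrBl pE pq qp subrr.
exists (unip_unit (flag_of1_square0 Xf)); first by exists (p - q).
rewrite /conj_end /= mulrDl mul1r mulrBl pE qp subrr addr0.
by rewrite mulrBr mulr1 mulrBr pE pq subKr.
Qed.

(** Write [p'] for the second conjugate of [p].  The flag of its kernel is
    transversal to the flag shared by the two images, so it is also the flag of
    the kernel of an idempotent [q] with the image of the first conjugate.  Then
    [ad q] and [ad p'] have the same flags, hence coincide, and as [q] is
    conjugate to [p'], [ad_conj_inj] gives [q = p']. *)
Lemma flag_of_act_inj p g h : idempotents V p ->
  flag_of (act_set g (endo_im p)) = flag_of (act_set h (endo_im p)) ->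
  act_set g (endo_im p) = act_set h (endo_im p).
Proof.
move=> pp; rewrite -!endo_im_conj => e.
have gp := conj_idempotent g pp; have hp := conj_idempotent h pp.
have flagP : flags L (flag_of (endo_ker (conj_end h p))).
  rewrite endo_ker_im // -flag_plus_ad; last exact: idempotentC.
  by exists (ad (1 - conj_end h p)) => //; apply/tripotent_gradings/idempotentC.
have tr : Defs.transversal (flag_of (endo_ker (conj_end h p)))
    (flag_of (endo_im (conj_end g p))).
  rewrite e -flag_plus_ad // -flag_minus_ad //.
  have [? ?] := flags_transversal end_ad_linear inv2 (ad_idempotent hp).
  by split.
have [q [qq imq ker]] := transversal_flag_of_im gp flagP tr.
have [u _ qE] := unip_conj_same_im gp qq (esym imq).
rewrite -imq; congr (endo_im _).
rewrite qE -conj_endM; apply: ad_conj_inj => //; rewrite conj_endM -qE.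
apply: (flags_inj end_ad_linear inv2); [exact: ad_idempotent .. | |].
  by rewrite !flag_plus_ad // imq e.
by rewrite !flag_minus_ad.
Qed.

(** * The elementary group acting on the Lie algebra *)

Fact conj_end_bracket g : {morph conj_end g : X Y / lie_bracket X Y}.
Proof.
move=> X Y; rewrite -[LHS]/(conj_end g (X * Y - Y * X)).
by rewrite conj_endB !conj_end_mul.
Qed.

Definition Ad g : lie_aut L :=
  LieAut (conj_end_linear g) (conj_end_bracket g) (conj_endK g) (conj_endKV g).

Lemma AdM : {morph Ad : g h / (g * h)%g}.
Proof. by move=> g h; apply: lie_aut_ext => X; apply: conj_endM. Qed.

(** Since X^2 = 0, (1 + X) y (1 - X) = y + [X, y] - X y X and
    [X, [X, y]] = - 2 X y X. *)
Lemma Ad_exp X g y : X * X = 0 -> uval g = 1 + X ->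
  Ad g y = y + ad X y + inv_two K *: ad X (ad X y).
Proof.
move=> XX gX; rewrite -[LHS]/(conj_end g y) /conj_end (unip_uinv XX gX) gX.
have -> : ad X (ad X y) = - (X * y * X) - (X * y * X).
  rewrite !end_adE mulrBr mulrBl !mulrA XX -[y * X * X]mulrA XX.
  by rewrite mulr0 mul0r subr0 sub0r.
rewrite inv_twoK // mulrBr mulr1 mulrDl mul1r mulrDl end_adE opprD !addrA.
by rewrite addrAC.
Qed.

Lemma image_Ad_unip E : Ad @` unip E = exp_ad (flag_of E).1.
Proof.
apply/seteqP; split=> [_ [g [X XE gX] <-] | u [X XE uX]].
  by exists X => // y; apply: Ad_exp => //; apply: flag_of1_square0 XE.
exists (unip_unit (flag_of1_square0 XE)); first by exists X.
apply: lie_aut_ext => y; rewrite uX.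
by apply: Ad_exp => //; apply: flag_of1_square0 XE.
Qed.

Lemma exp_adU (S T : set L) : exp_ad (S `|` T) = exp_ad S `|` exp_ad T.
Proof.
apply/seteqP; split=> u; first by case=> X [SX|TX] uX; [left|right]; exists X.
by case=> -[X ? uX]; exists X => //; [left|right].
Qed.

Lemma elem_group_ad p : idempotents V p ->
  elem_group (ad p) = Ad @` elem_GL (endo_im p) (endo_ker p).
Proof.
move=> pp; rewrite /elem_GL (image_generated _ AdM) image_setU !image_Ad_unip.
by rewrite -exp_adU -flag_plus_ad // -flag_minus_ad.
Qed.

Lemma eq_idempotent p q : idempotents V p -> idempotents V q ->
  endo_im p = endo_im q -> endo_ker p = endo_ker q -> p = q.
Proof.
move=> pp qq /(endo_im_eqP pp qq)[pq _].
rewrite !endo_ker_im // => /(endo_im_eqP (idempotentC pp) (idempotentC qq))[+ _].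
by rewrite mulrBl mul1r mulrBr mulr1 pq -[RHS]subr0 => /addrI/oppr_inj/subr0_eq.
Qed.

Lemma stab_both_conj p : idempotents V p ->
  stab_both (endo_im p) (endo_ker p) =
    [set g | elem_GL (endo_im p) (endo_ker p) g /\ conj_end g p = p].
Proof.
move=> pp; apply/seteqP; split=> g /= [Gg].
  rewrite -endo_im_conj -endo_ker_conj => im ker.
  by split=> //; apply: eq_idempotent => //; apply: conj_idempotent.
by move=> gp; split; rewrite // -?endo_im_conj -?endo_ker_conj gp.
Qed.

Lemma centr_group_stab (D : L -> L) :
  centr_group D = [set u | elem_group D u /\ aut_grading u D = D].
Proof.
apply/seteqP; split=> u /= [Du uD]; split=> //; apply/funext => X.
  by rewrite /aut_grading uD /= aut_invK.
have /(congr1 (@^~ (u X))) := uD.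
by rewrite /aut_grading /= aut_funK.
Qed.

HB.instance Definition _ (u : lie_aut L) :=
  GRing.isLinear.Build K L L *:%R (aut_fun u) (aut_linear u).

Lemma image_eigenset (u : lie_aut L) (D : L -> L) i :
  u @` eigenset D i = eigenset (aut_grading u D) i.
Proof.
apply/seteqP; split=> [_ [X DX <-] | X DX].
  by rewrite /eigenset /aut_grading /= aut_funK DX raddfMz.
exists (aut_inv u X); last exact: aut_invK.
apply: (can_inj (aut_funK u)); rewrite raddfMz /= aut_invK.
exact: DX.
Qed.

Lemma aut_flag_minus (u : lie_aut L) (D : L -> L) :
  aut_flag u (flag_minus D) = flag_minus (aut_grading u D).
Proof.
rewrite /flag_minus -!image_eigenset; congr pair; apply/seteqP; split.
  move=> _ [_ [X DX [Y DY <-]] <-]; exists (u X); first by exists X.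
  by exists (u Y); [exists Y | rewrite raddfD].
move=> _ [_ [X DX <-] [_ [Y DY <-] <-]]; exists (X + Y); last by rewrite raddfD.
by exists X => //; exists Y.
Qed.

Lemma aut_flag1 f : aut_flag (1%g : lie_aut L) f = f.
Proof. by case: f => e f; congr pair; apply: image_id. Qed.

Lemma aut_flagM (u v : lie_aut L) f :
  aut_flag (u * v)%g f = aut_flag u (aut_flag v f).
Proof. by congr pair; apply/esym/image_comp. Qed.

(** A unipotent element of [E] fixes [E] pointwise. *)
Lemma unip_act_set E g : unip E g -> act_set g E = E.
Proof.
move=> [X [_ X0] gX]; have gE v : E v -> uval g v = v.
  by move=> Ev; rewrite gX /= X0 // addr0.
apply/seteqP; split=> [_ [v Ev <-] | v Ev]; first by rewrite gE.
by exists v; rewrite ?gE.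
Qed.

Lemma unipV E g : is_submodule E -> unip E g -> unip E g^-1%g.
Proof.
move=> [_ _ EZ] [X XE gX]; exists (- X); last first.
  exact: unip_uinv (flag_of1_square0 XE) gX.
case: XE => XE X0; split=> v; first by rewrite /= -scaleN1r; apply: EZ.
by move=> Ev; rewrite /= X0 ?oppr0.
Qed.

(** An element [Ad g] stabilising the flag of [F = endo_ker p] satisfies
    [g F = F], by injectivity of [F |-> flag_of F] on orbits.  So the conjugate
    of [p] by the inverse of [g] has kernel [F] again, hence is also the conjugate
    of [p] by some unipotent [h] of [F].  Then [g h] commutes with [p], and
    [g = (g h) h^-1] is the required factorisation. *)
Lemma parab_minus_stab p : idempotents V p ->
  parab_minus (ad p) =
    [set u | elem_group (ad p) u /\
             aut_flag u (flag_of (endo_ker p)) = flag_of (endo_ker p)].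
Proof.
move=> pp; set F := endo_ker p; have cp := idempotentC pp.
have sF : is_submodule F by rewrite /F endo_ker_im //; apply: endo_im_submodule.
have expE : exp_ad (eigenset (ad p) (-1)) = Ad @` unip F.
  by rewrite image_Ad_unip -flag_minus_ad.
have sG := generated_is_subgroup (unip (endo_im p) `|` unip F).
have unipG h : unip F h -> elem_GL (endo_im p) F h.
  by move=> hF; apply: sub_generated; right.
rewrite /parab_minus expE centr_group_stab elem_group_ad //.
apply/seteqP; split=> [_ [u [[g Gg gu] up] [_ [h hF <-] <-]] | _ [[g Gg <-] gF]].
  split.
    exists (g * h)%g; last by rewrite AdM gu.
    exact: (is_subgroupM sG Gg (unipG _ hF)).
  have hf : aut_flag (Ad h) (flag_of F) = flag_of F.
    by rewrite -[LHS]flag_of_act_set unip_act_set.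
  by rewrite aut_flagM hf -flag_minus_ad // aut_flag_minus up.
have gFF : act_set g F = F.
  rewrite -[RHS]act_set1 /F endo_ker_im //; apply: flag_of_act_inj => //.
  by rewrite -endo_ker_im // act_set1 -[RHS]gF flag_of_act_set.
pose q := conj_end g^-1%g p.
have qq : idempotents V q by apply: conj_idempotent.
have kq : endo_ker q = F.
  by rewrite endo_ker_conj -/F -{1}gFF -act_setM mulVg act_set1.
have [h hF qE] : exists2 h, unip F h & 1 - q = conj_end h (1 - p).
  rewrite /F endo_ker_im //.
  apply: unip_conj_same_im => //; first exact: idempotentC.
  by rewrite -!endo_ker_im.
have hp : conj_end h p = q.
  move: qE; rewrite conj_endB [conj_end h 1]/conj_end mulr1 uvalK.
  by move=> /addrI/oppr_inj ->.
exists (Ad (g * h)%g).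
  split.
    by exists (g * h)%g => //; exact: (is_subgroupM sG Gg (unipG _ hF)).
  by rewrite -[LHS]ad_conj_end conj_endM hp conj_endKV.
exists (Ad h^-1%g); first by exists h^-1%g => //; apply: unipV.
by rewrite -AdM -mulgA mulgV mulg1.
Qed.

End Idempotents.

Theorem theorem8p4 (K : comPzRingType) (R : pzAlgebra K) (V : lmodType R^c)
  (inv2 : invertible (2%:R : K)) (inv3 : invertible (3%:R : K)) :
  (* ad : P -> G and E |-> f_E : C -> F are well defined and equivariant *)
  [/\ forall p : endR V, idempotents V p -> gradings (endR V) (ad p),
      forall E : set V, compl_submodules E -> flags (endR V) (flag_of E),
      forall (g : units (endR V)) (p : endR V), idempotents V p ->
        ad (conj_end g p) = conj_grading g (ad p)
    & forall (g : units (endR V)) (E : set V), compl_submodules E ->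
        flag_of (act_set g E) = conj_flag g (flag_of E)]
  /\
  [/\ (* (1) *)
      forall E : set V, compl_submodules E ->
        flag_of @` complements E = flag_top (flag_of E),
      (* (2) *)
      forall p : endR V, idempotents V p ->
        set_inj (act_orbit conj_end [set: units (endR V)] p) ad,
      (* (3) *)
      forall E : set V, compl_submodules E ->
        set_inj (act_orbit act_set [set: units (endR V)] E) flag_of
    & (* (4) *)
      forall p : endR V, idempotents V p ->
        let E := endo_im p in
        let F := endo_ker p in
        let D := ad p in
        [/\ act_orbit_iso conj_end (elem_GL E F) (stab_both E F) p,
            set_bij (act_orbit conj_end (elem_GL E F) p)
              (act_orbit aut_grading (elem_group D) D) ad
          & act_orbit_iso aut_grading (elem_group D) (centr_group D) D]
        /\
        [/\ act_orbit_iso act_set (elem_GL E F) (stab_snd E F) F,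
            set_bij (act_orbit act_set (elem_GL E F) F)
              (act_orbit aut_flag (elem_group D) (flag_of F)) flag_of
          & act_orbit_iso aut_flag (elem_group D) (parab_minus D) (flag_of F)]].
Proof.
have flagsP (p : endR V) :
    idempotents V p -> flags (endR V) (flag_of (endo_im p)).
  move=> pp; rewrite -flag_plus_ad //.
  by exists (ad p) => //; apply: tripotent_gradings.
split; first split.
- exact: tripotent_gradings.
- by move=> E /compl_submodulesE[p [pp ->]]; apply: flagsP.
- by move=> g p _; apply: ad_conj_end.
- by move=> g E _; apply: flag_of_act_set.
split.
- move=> E EC; have [sE _] := EC; apply/seteqP; split.
    move=> _ [F [[sF _] EF] <-].
    have [p [pp im ker]] := projection_exists sE sF EF.
    split; first by rewrite -ker endo_ker_im //; apply/flagsP/idempotentC.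
    rewrite -im -ker -flag_plus_ad // -flag_minus_ad //.
    have [? ?] :=
      flags_transversal (end_ad_linear (V := V)) inv2 (ad_idempotent pp).
    by split.
  have /compl_submodulesE[p [pp ->]] := EC.
  move=> e [eF tr].
  have [q [qq im ->]] := transversal_flag_of_im inv2 inv3 pp eF tr.
  exists (endo_ker q) => //; split; last by rewrite -im; apply: endo_im_ker_sum.
  apply/compl_submodulesE; exists (1 - q).
  by rewrite -endo_ker_im //; split=> //; apply: idempotentC.
- move=> p pp _ _ /set_mem[g _ <-] /set_mem[h _ <-].
  exact: ad_conj_inj.
- move=> E /compl_submodulesE[p [pp ->]] _ _ /set_mem[g _ <-] /set_mem[h _ <-].
  exact: flag_of_act_inj.
move=> p pp E F D; have cp := idempotentC pp.
have sG : is_subgroup (elem_GL E F) by apply: generated_is_subgroup.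
have sU : is_subgroup (elem_group D) by apply: generated_is_subgroup.
split; split.
- rewrite stab_both_conj //; apply: act_orbit_iso_stabilizer => //.
    exact: conj_end1.
  exact: conj_endM.
- split.
  + move=> _ [g Gg <-]; rewrite ad_conj_end elem_group_ad //.
    by exists (Ad g) => //; exists g.
  + by move=> _ _ /set_mem[g _ <-] /set_mem[h _ <-]; apply: ad_conj_inj.
  + move=> _ [u + <-]; rewrite elem_group_ad // => -[g Gg <-].
    by exists (conj_end g p); [exists g | exact: ad_conj_end].
- by rewrite centr_group_stab; apply: act_orbit_iso_stabilizer.
- by apply: act_orbit_iso_stabilizer => //; [exact: act_set1 | exact: act_setM].
- split.
  + move=> _ [g Gg <-]; rewrite flag_of_act_set elem_group_ad //.
    by exists (Ad g) => //; exists g.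
  + move=> _ _ /set_mem[g _ <-] /set_mem[h _ <-].
    by rewrite /F endo_ker_im //; apply: flag_of_act_inj.
  + move=> _ [u + <-]; rewrite elem_group_ad // => -[g Gg <-].
    by exists (act_set g F); [exists g | exact: flag_of_act_set].
- rewrite parab_minus_stab //; apply: act_orbit_iso_stabilizer => //.
    exact: aut_flag1.
  exact: aut_flagM.
Qed.
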